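(* Let $f$ be an absolutely integrable analog signal, and consider the analog signals $x_\omega(t)=e^{j\omega t}$ (a signal in the variable $t\in\mathbb{R}$, for fixed $\omega\in\mathbb{R}$) and $\bar x_t(\omega)=e^{-j\omega t}$ (a signal in the variable $\omega\in\mathbb{R}$, for fixed $t\in\mathbb{R}$). Then we have the following pair of equations: $$(f*x_\omega)(t)=F(\omega)\,x_\omega(t),$$ $$(F*\bar x_t)(\omega)=2\pi f(t)\,\bar x_t(\omega),$$ and $$F(\omega)=\int_{-\infty}^{\infty}f(\tau)e^{-j\omega\tau}\,d\tau$$ is the Fourier transform of $f$.
   Context: Here $j$ is the imaginary unit. An analog signal is a function $\mathbb{R}\to\mathbb{C}$; its independent variable may be time $t$ or frequency $\omega$. The (analog) convolution of two analog signals $f$ and $g$ is the signal $f*g$ defined by $(f*g)(t)=\int_{-\infty}^{\infty}f(\tau)g(t-\tau)\,d\tau$; for the convolution to be well defined, this integral is required to be absolutely convergent. In $F*\bar x_t$ the convolution is taken in the frequency variable, i.e. $(F*\bar x_t)(\omega)=\int_{-\infty}^{\infty}F(\nu)\,\bar x_t(\omega-\nu)\,d\nu$.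
   Formalization: f is taken Borel measurable; the second equation is proved only where F * x̄_t converges absolutely, for almost every t and at each t where f is continuous, since it fails if f is altered at one point and F need not be absolutely integrable. *)

(* Defs.v *)
From HB Require Import structures.
From mathcomp Require Export all_boot all_order all_algebra.
From mathcomp Require Export complex.
From mathcomp Require Export all_classical all_reals all_analysis.

Set Implicit Arguments.
Unset Strict Implicit.
Unset Printing Implicit Defensive.

Import Order.TTheory GRing.Theory Num.Theory.
Import numFieldNormedType.Exports.

Local Open Scope classical_set_scope.
Local Open Scope ring_scope.
Local Open Scope complex_scope.

Section signals.
Context {R : realType}.

Definition signal := R -> R[i].

Implicit Types (f g : signal) (t omega : R) (z : R[i]).

Definition jC : R[i] := 0 +i* 1.

(* The library has no exponential on R[i]: e^(a + jb) = e^a (cos b + j sin b). *)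
Definition cexp z : R[i] :=
  (expR (complex.Re z))%:C * (cos (complex.Im z) +i* sin (complex.Im z)).

(* [0,+oo]-valued integral of the modulus; R carries its Borel sigma-algebra,
   and a complex signal is measurable when its two components are. *)
Definition abs_integrable f : Prop :=
  [/\ measurable_fun [set: R] (fun x => complex.Re (f x)),
      measurable_fun [set: R] (fun x => complex.Im (f x)) &
      (\int[lebesgue_measure]_x (Normc.normc (f x))%:E < +oo)%E].

(* Total operator: the integral proper only when f is absolutely integrable,
   which conv_defined asserts for the integrand of a convolution. *)
Definition cintegral f : R[i] :=
  (\int[lebesgue_measure]_x complex.Re (f x)) +i*
  (\int[lebesgue_measure]_x complex.Im (f x)).

Definition conv_defined f g t : Prop :=
  abs_integrable (fun tau => f tau * g (t - tau)).

Definition conv f g : signal :=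
  fun t => cintegral (fun tau => f tau * g (t - tau)).

Definition xsig omega : signal := fun t => cexp (jC * (omega * t)%:C).

Definition xbar t : signal := fun omega => cexp (- jC * (omega * t)%:C).

Definition fourier f : signal :=
  fun omega => cintegral (fun tau => f tau * cexp (- jC * (omega * tau)%:C)).

Definition csignal_continuous_at f t : Prop :=
  {for t, continuous (fun s => complex.Re (f s))} /\
  {for t, continuous (fun s => complex.Im (f s))}.

End signals.
Arguments signal : clear implicits.

(* Main.v *)
Require Import Defs.
From mathcomp Require Import measurable_realfun ring.
Import Order.TTheory GRing.Theory Num.Theory.
Import numFieldNormedType.Exports.

(** The first equation is the functional equation of the exponential: in
[f * x_omega] the factor [exp (j omega (t - tau))] splits into
[exp (- j omega tau)], which turns the integral into [F omega], and
[exp (j omega t)], which leaves it.  The same splitting turns the second equation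
into the Fourier inversion formula
[int F(nu) exp (j nu t) dnu = 2 pi f(t)]; the convolution is defined exactly when
[F] is absolutely integrable.

Inversion is proved after integrating in [t] over a window [[a, b]], by Abel
summation.  Damping the spectrum by [exp (- e |nu|)] makes Fubini applicable and
replaces [int F(nu) exp (j nu s) dnu] by the convolution of [f] with the Poisson
kernel [2 e / (e^2 + x^2)] ([abel_sum_spectrum]).  Its primitive is an
arctangent, so integration over [s] in [[a, b]] yields
[int f(tau) 2 (atan ((b - tau) / e) - atan ((a - tau) / e)) dtau]
([Rintegral_window_poisson]).  As [e] tends to 0 the bracket stays bounded and
tends to [2 pi] inside the window and to 0 outside, hence dominated convergence
gives [int_a^b g = 2 pi int_a^b f], where [g(s) = int F(nu) exp (j nu s) dnu]
([Rintegral_window_inversion]).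

So the defect [2 pi f - g] has zero integral over every window, and it vanishes
wherever its averages over shrinking intervals converge to its value, that is at
its Lebesgue points ([lebesgue_pt_eq0]).  Almost every point is one by the
Lebesgue differentiation theorem; every continuity point of [f] is one because
[g] is continuous.  Both parts of the statement follow.

The analysis is carried out on real functions.  A signal [p + j q] enters through
[wave p q x], the real part of [(p + j q) exp (j x)]; imaginary parts come from the
same lemmas applied to [- j (p + j q) = q - j p]. *)

Local Open Scope classical_set_scope.
Local Open Scope ring_scope.

(** * Real-valued dominated convergence and Fubini *)

Lemma le_integrable_EFin d (T : measurableType d) (R : realType)
    (mu : {measure set T -> \bar R}) (D : set T) (f g : T -> R) :
  measurable D -> measurable_fun D f -> (forall x, D x -> `|f x| <= g x) ->
  mu.-integrable D (EFin \o g) -> mu.-integrable D (EFin \o f).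
Proof.
move=> mD mf fg; apply: le_integrable => //; first exact/measurable_EFinP.
by move=> x Dx; rewrite lee_fin (le_trans (fg _ Dx))// ler_norm.
Qed.

Arguments le_integrable_EFin {d T R mu D} f g.

Lemma cvg_Rintegral_dominated d (T : measurableType d) (R : realType)
    (mu : {measure set T -> \bar R}) (D : set T)
    (f_ : nat -> T -> R) (f g : T -> R) :
  measurable D -> (forall n, measurable_fun D (f_ n)) -> measurable_fun D f ->
  {ae mu, forall x, D x -> f_ n x @[n --> \oo] --> f x} ->
  mu.-integrable D (EFin \o g) ->
  (forall n x, D x -> `|f_ n x| <= g x) ->
  \int[mu]_(x in D) f_ n x @[n --> \oo] --> \int[mu]_(x in D) f x.
Proof.
move=> mD mf_ mf cf ig fg.
have if_ n : mu.-integrable D (EFin \o f_ n).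
  by apply: le_integrable_EFin ig => //; exact: fg.
have [] := @dominated_convergence _ _ _ mu D mD (fun n => EFin \o f_ n)
  (EFin \o f) (EFin \o g).
- by move=> n; exact/measurable_EFinP.
- exact/measurable_EFinP.
- apply: filterS cf => x + Dx => /(_ Dx) h.
  by apply/fine_cvgP; split; [exact: nearW|exact: h].
- exact: ig.
- by apply: aeW => x n Dx; rewrite lee_fin fg.
move=> intf _; rewrite -(fineK (integrable_fin_num mD intf)).
by move=> /fine_cvgP[_].
Qed.

(** A bound by a tensor product of integrable functions makes every section of
[h] integrable, so that the inner integrals are finite at all points and Fubini
can be read on real-valued integrals. *)
Lemma Rintegral_swap_dominated d1 d2 (T1 : measurableType d1)
    (T2 : measurableType d2) (R : realType)
    (m1 : {sigma_finite_measure set T1 -> \bar R})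
    (m2 : {sigma_finite_measure set T2 -> \bar R})
    (h : T1 * T2 -> R) (u : T1 -> R) (v : T2 -> R) :
  measurable_fun setT h -> (forall z, `|h z| <= u z.1 * v z.2) ->
  m1.-integrable setT (EFin \o u) -> m2.-integrable setT (EFin \o v) ->
  \int[m1]_x \int[m2]_y h (x, y) = \int[m2]_y \int[m1]_x h (x, y).
Proof.
move=> mh huv iu iv.
have mu_ : measurable_fun setT u.
  by apply/measurable_EFinP; exact: measurable_int iu.
have mv_ : measurable_fun setT v.
  by apply/measurable_EFinP; exact: measurable_int iv.
have ih1 x : m2.-integrable setT (EFin \o (fun y => h (x, y))).
  apply: (le_integrable_EFin _ (fun y => u x * v y)) => //.
    exact: measurableT_comp.
  exact: (integrableZl measurableT (u x) iv).
have ih2 y : m1.-integrable setT (EFin \o (fun x => h (x, y))).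
  apply: (le_integrable_EFin _ (fun x => u x * v y)) => //.
    exact: measurableT_comp.
  by under eq_fun do rewrite mulrC; exact: (integrableZl measurableT (v y) iu).
have ih : (m1 \x m2)%E.-integrable setT (EFin \o h).
  apply/integrable12ltyP; first exact/measurable_EFinP.
  apply: (@le_lt_trans _ _
    (\int[m1]_x (`|u x|%:E * \int[m2]_y `|v y|%:E))%E).
    apply: ge0_le_integral => //=.
    - by move=> x _; exact: integral_ge0.
    - apply: (measurable_fun_fubini_tonelli_F (fun z => `|h z|%:E)) => //.
      by apply/measurable_EFinP; exact: measurableT_comp.
    - apply: emeasurable_funM => //; first exact/measurable_EFinP/measurableT_comp.
    - move=> x _; rewrite -ge0_integralZl//; last first.
        by apply/measurable_EFinP; exact: measurableT_comp.
      apply: ge0_le_integral => //=.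
      + by apply/measurable_EFinP; do 2 apply: measurableT_comp => //.
      + apply/measurable_EFinP/measurable_funM => //; exact: measurableT_comp.
      + move=> y _; rewrite -EFinM lee_fin -normrM.
        by rewrite (le_trans (huv _))//= ler_norm.
  have [_ iu_] := integrableP _ _ _ iu; have [_ iv_] := integrableP _ _ _ iv.
  rewrite ge0_integralZr//=.
  - by rewrite lte_mul_pinfty ?integral_ge0// ge0_fin_numE ?integral_ge0.
  - by apply/measurable_EFinP; exact: measurableT_comp.
  - exact: integral_ge0.
have := Fubini ih => /(congr1 fine).
have -> : (\int[m1]_x \int[m2]_y (EFin \o h) (x, y) =
    \int[m1]_x (\int[m2]_y h (x, y))%:E)%E.
  apply: eq_integral => x _; rewrite fineK//.
  exact: integrable_fin_num (ih1 x).
have -> : (\int[m2]_y \int[m1]_x (EFin \o h) (x, y) =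
    \int[m2]_y (\int[m1]_x h (x, y))%:E)%E.
  apply: eq_integral => y _; rewrite fineK//.
  exact: integrable_fin_num (ih2 y).
by [].
Qed.

(** * Abel means of a wave and the Poisson kernel *)

Section kernel.
Context {R : realType}.
Local Notation mu := (@lebesgue_measure R).
Implicit Types (e x c nu M : R) (f : R -> R).

(** The real part of [(p + j q) exp (j x)]. *)
Definition wave (p q x : R) : R := p * cos x - q * sin x.

Lemma normr_wave p q x : `|wave p q x| <= `|p| + `|q|.
Proof.
rewrite /wave (le_trans (ler_normB _ _))// lerD// normrM ler_piMr//.
  by rewrite ler_norml cos_geN1 cos_le1.
by rewrite ler_norml sin_geN1 sin_le1.
Qed.

Lemma continuous_wave p q : continuous (wave p q).
Proof.
move=> x; apply: cvgB; apply: cvgM; try exact: cvg_cst.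
  exact: continuous_cos.
exact: continuous_sin.
Qed.

(** Folding the line at the origin cancels odd parts: this is how the sine terms
disappear below. *)
Lemma ge0_integralT_fold f : (forall x, 0 <= f x) -> continuous f ->
  (\int[mu]_x (f x)%:E = \int[mu]_(x in `[0%R, +oo[) (f x + f (- x))%:E)%E.
Proof.
move=> f0 cf.
have mf : measurable_fun [set: R] f by exact: continuous_measurable_fun.
have mfN : measurable_fun [set: R] (f \o -%R).
  by apply: measurableT_comp => //; exact: oppr_measurable.
rewrite -(setUv (`[0%R, +oo[ : set R)) ge0_integral_setU//=; last 4 first.
- exact: measurableC.
- by apply/measurable_EFinP; rewrite setUv.
- by move=> x _; rewrite lee_fin.
- exact/disj_setPCl.
under [RHS]eq_integral do rewrite EFinD.
rewrite ge0_integralD//; last 4 first.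
- by move=> x _; rewrite lee_fin.
- by apply/measurable_EFinP; exact: measurable_funTS.
- by move=> x _; rewrite lee_fin.
- by apply/measurable_EFinP; exact: measurable_funTS.
congr +%E.
rewrite setCitvr integral_itv_bndo_bndc; last first.
  exact/measurable_EFinP/measurable_funTS.
rewrite -{1}oppr0 ge0_integration_by_substitutionNy//.
exact: continuous_subspaceT.
Qed.

Definition poisson e x : R := 2 * e / (e ^+ 2 + x ^+ 2).

(** A primitive of [exp (- e nu) (2 M + 2 c cos (nu x))]. For
[|c| <= M] the integrand is nonnegative, so that its improper integral is read
off the limit of the primitive at infinity. *)
Definition abel_primitive e M c x nu : R :=
  expR (- e * nu) *
  (c * (2 * (x * sin (nu * x) - e * cos (nu * x))) / (e ^+ 2 + x ^+ 2)
   - 2 * M / e).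

Lemma sumsq_gt0 e x : 0 < e -> 0 < e ^+ 2 + x ^+ 2.
Proof. by move=> e0; rewrite ltr_wpDr ?sqr_ge0// exprn_gt0. Qed.

Lemma scaleRE (k y : R) : k *: y = k * y. Proof. by []. Qed.

Lemma is_derive_sinM x nu :
  is_derive nu 1 (fun n : R => sin (n * x)) (cos (nu * x) * x).
Proof.
have := @is_derive1_comp R sin ( *%R^~ x) nu (cos (nu * x)) x.
by apply; apply: is_derive_eq; rewrite scaler0 add0r /GRing.scale/= mulr1.
Qed.

Lemma is_derive_cosM x nu :
  is_derive nu 1 (fun n : R => cos (n * x)) (- sin (nu * x) * x).
Proof.
have := @is_derive1_comp R cos ( *%R^~ x) nu (- sin (nu * x)) x.
by apply; apply: is_derive_eq; rewrite scaler0 add0r /GRing.scale/= mulr1.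
Qed.

Lemma is_derive_abel_primitive e M c x nu : 0 < e ->
  is_derive nu 1 (abel_primitive e M c x)
    (expR (- e * nu) * (2 * M + 2 * c * cos (nu * x))).
Proof.
move=> e0; have d0 := sumsq_gt0 e x e0.
have dS := is_derive_sinM x nu; have dC := is_derive_cosM x nu.
have dE : is_derive nu 1 (fun n : R => expR (- e * n)) (expR (- e * nu) * - e).
  have := @is_derive1_comp R expR ( *%R (- e)) nu (expR (- e * nu)) (- e).
  apply; apply: is_derive_eq.
  by rewrite ?scaler0 ?addr0 ?add0r /GRing.scale/= mulr1.
pose d := e ^+ 2 + x ^+ 2.
pose B (n : R) :=
  c * (2 * (x * sin (n * x) - e * cos (n * x))) / d - 2 * M / e.
have dB : is_derive nu 1 B
    (c * (2 * (x * (cos (nu * x) * x) - e * (- sin (nu * x) * x))) / d).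
  have -> : B = (2 * c * x / d) \*: (fun n => sin (n * x)) -
      (2 * c * e / d) \*: (fun n => cos (n * x)) - cst (2 * M / e).
    by apply/funext => n; rewrite /B !fctE /= !scaleRE; ring.
  by apply: is_derive_eq; rewrite !scaleRE; ring.
have := is_deriveM dE dB.
rewrite (_ : _ * B = abel_primitive e M c x)// => h; apply: (is_derive_eq h).
by rewrite /B /d !scaleRE; field; rewrite !gt_eqF.
Qed.

Lemma continuous_comp_mulr x f :
  continuous f -> continuous (fun nu => f (nu * x)).
Proof.
move=> cf nu; rewrite -/(f \o (fun n => n * x)).
by apply: continuous_comp; [apply: cvgMr_tmp; exact: cvg_id|exact: cf].
Qed.

Lemma cvg_abel_primitive e M c x : 0 < e ->
  abel_primitive e M c x nu @[nu --> +oo] --> 0.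
Proof.
move=> e0; have d0 := sumsq_gt0 e x e0.
pose K := `|c| * (2 * (`|x| + e)) / (e ^+ 2 + x ^+ 2) + `|2 * M / e|.
have E0 : expR (- e * nu) @[nu --> +oo] --> 0.
  under eq_fun do rewrite mulNr mulrC.
  have ey : nu * e @[nu --> +oo] --> +oo.
    by apply: gt0_cvgMly => //; exact: cvg_id.
  exact: (cvg_comp _ _ ey (@cvgr_expR R)).
apply: norm_cvg0.
apply: (@squeeze_cvgr _ _ _ _ (cst 0) (fun nu => expR (- e * nu) * K)).
- near=> nu; rewrite normr_ge0/= /abel_primitive normrM ger0_norm ?expR_ge0//.
  rewrite ler_wpM2l ?expR_ge0// (le_trans (ler_normB _ _))// lerD//.
  rewrite !normrM normfV (gtr0_norm d0) ler_wpM2r ?invr_ge0 ?(ltW d0)//.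
  rewrite ler_wpM2l// ger0_norm// ler_wpM2l// (le_trans (ler_normB _ _))// lerD//.
    by rewrite normrM ler_piMr// ler_norml sin_geN1 sin_le1.
  rewrite normrM (gtr0_norm e0) ler_piMr ?(ltW e0)//.
  by rewrite ler_norml cos_geN1 cos_le1.
- exact: cvg_cst.
- by rewrite -[X in _ --> X](mul0r K); apply: cvgMr_tmp.
Unshelve. all: by end_near. Qed.

Lemma integral_abel_cos e M c x : 0 < e -> `|c| <= M ->
  (\int[mu]_(nu in `[0%R, +oo[)
     (expR (- e * nu) * (2 * M + 2 * c * cos (nu * x)))%:E =
   (2 * M / e + c * poisson e x)%:E)%E.
Proof.
move=> e0 cM.
have dF nu := is_derive_abel_primitive e M c x nu e0.
have cF : continuous (abel_primitive e M c x).
  by move=> nu; apply/differentiable_continuous/derivable1_diffP; case: (dF nu).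
rewrite (@ge0_continuous_FTC2y _ _ (abel_primitive e M c x) _ 0).
- rewrite -EFinB /abel_primitive /poisson mulr0 expR0 mul0r sin0 cos0.
  by congr (_%:E); field; rewrite !gt_eqF// sumsq_gt0.
- move=> nu _; rewrite mulr_ge0 ?expR_ge0//.
  rewrite -mulrA -mulrDr mulr_ge0// -lerBlDl sub0r lerNl.
  apply: le_trans cM; rewrite (le_trans (ler_norm _))// normrN normrM ler_piMr//.
  by rewrite ler_norml cos_geN1 cos_le1.
- apply: continuous_subspaceT => nu; apply: cvgM.
    apply: (@continuous_comp _ _ _ ( *%R (- e)) expR).
      by apply: cvgMl_tmp; exact: cvg_id.
    exact: continuous_expR.
  apply: cvgD; first exact: cvg_cst.
  apply: cvgMl_tmp.
  exact: (continuous_comp_mulr x cos (@continuous_cos R)).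
- exact: cvg_abel_primitive.
- by move=> nu _; case: (dF nu).
- exact/cvg_at_right_filter/cF.
- by move=> nu _; rewrite derive1E; case: (dF nu).
Qed.

(** The damping factor of Abel summation. *)
Definition abel_weight e nu := expR (- e * `|nu|).

Lemma abel_weight_ge0 e nu : 0 <= abel_weight e nu.
Proof. exact: expR_ge0. Qed.

Lemma abel_weight_le1 e nu : 0 < e -> abel_weight e nu <= 1.
Proof. by move=> e0; rewrite -expR0 ler_expR mulNr oppr_le0 mulr_ge0// ltW. Qed.

Lemma continuous_abel_weight e : continuous (abel_weight e).
Proof.
move=> nu; apply: (@continuous_comp _ _ _ (fun nu => - e * `|nu|) expR).
  by apply: cvgMl_tmp; exact: norm_continuous.
exact: continuous_expR.
Qed.

Lemma measurable_abel_weight e D : measurable_fun D (abel_weight e).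
Proof.
apply: measurable_funTS; apply: continuous_measurable_fun.
exact: continuous_abel_weight.
Qed.

(** The part of [wave p q] that is odd in [nu] integrates to 0 against the even
weight, which is why [q] is absent from the right-hand side. *)
Lemma integral_abel_wave_ge0 e M p q x : 0 < e -> `|p| + `|q| <= M ->
  (\int[mu]_nu (abel_weight e nu * (M + wave p q (nu * x)))%:E =
   (2 * M / e + p * poisson e x)%:E)%E.
Proof.
move=> e0 pqM; rewrite ge0_integralT_fold.
- have pM : `|p| <= M by rewrite (le_trans _ pqM)// lerDl.
  rewrite -(integral_abel_cos e M p x e0 pM).
  apply: eq_integral => nu; rewrite inE/= in_itv/= andbT => nu0.
  congr (_%:E); rewrite /abel_weight normrN (ger0_norm nu0) /wave.
  rewrite (mulNr nu) cosN sinN.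
  ring.
- move=> nu; rewrite mulr_ge0 ?abel_weight_ge0// -lerBlDl sub0r lerNl.
  rewrite (le_trans _ pqM)// (le_trans _ (normr_wave p q (nu * x)))//.
  by rewrite -normrN ler_norm.
- move=> nu; apply: cvgM; first exact: continuous_abel_weight.
  apply: cvgD; first exact: cvg_cst.
  exact: (continuous_comp_mulr x (wave p q) (continuous_wave p q)).
Qed.

Lemma integrable_abel_weight e : 0 < e ->
  mu.-integrable setT (EFin \o abel_weight e).
Proof.
move=> e0; apply/integrableP; split.
  by apply/measurable_EFinP; exact: measurable_abel_weight.
have := @integral_abel_wave_ge0 e 1 0 0 0 e0.
rewrite normr0 addr0 => /(_ ler01) h.
suff <- : (\int[mu]_nu (abel_weight e nu * (1 + wave 0 0 (nu * 0)))%:E =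
    \int[mu]_nu `|(EFin \o abel_weight e) nu|)%E by rewrite h ltry.
apply: eq_integral => nu _.
by rewrite /wave !mul0r subr0 addr0 mulr1 /= ger0_norm ?abel_weight_ge0.
Qed.

Lemma measurable_wave_mulr p q x :
  measurable_fun setT (fun nu => wave p q (nu * x)).
Proof.
apply: continuous_measurable_fun.
exact: (continuous_comp_mulr x (wave p q) (continuous_wave p q)).
Qed.

Lemma integrable_abel_wave e p q x : 0 < e ->
  mu.-integrable setT (EFin \o (fun nu => abel_weight e nu * wave p q (nu * x))).
Proof.
move=> e0.
apply: (le_integrable measurableT _ _
  (integrableZl measurableT (`|p| + `|q|) (integrable_abel_weight e e0))).
  apply/measurable_EFinP/measurable_funM; last exact: measurable_wave_mulr.
  exact: measurable_abel_weight.
move=> nu _; rewrite /= lee_fin normrM ger0_norm ?abel_weight_ge0// mulrC.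
rewrite [leRHS]ger0_norm ?mulr_ge0 ?addr_ge0 ?abel_weight_ge0//.
by rewrite ler_wpM2r ?abel_weight_ge0// normr_wave.
Qed.

(** Removes the shift by [M], as the difference of two instances of
[integral_abel_wave_ge0]. *)
Lemma Rintegral_abel_wave e p q x : 0 < e ->
  \int[mu]_nu (abel_weight e nu * wave p q (nu * x)) = p * poisson e x.
Proof.
move=> e0; pose M := `|p| + `|q|.
have iw := integrable_abel_weight e e0.
have M0 : `|0 : R| + `|0 : R| <= M by rewrite normr0 addr0 addr_ge0.
have iM p' q' : mu.-integrable setT
    (EFin \o (fun nu => abel_weight e nu * (M + wave p' q' (nu * x)))).
  apply: (eq_integrable measurableT _ _ _ (integrableD measurableT
    (integrableZl measurableT M iw) (integrable_abel_wave e p' q' x e0))).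
  by move=> nu _ /=; rewrite -EFinM -EFinD [in RHS]mulrDr (mulrC M).
transitivity (\int[mu]_nu (abel_weight e nu * (M + wave p q (nu * x))) -
              \int[mu]_nu (abel_weight e nu * (M + wave 0 0 (nu * x))))%R.
  rewrite -RintegralB//; apply: eq_Rintegral => nu _.
  by rewrite /wave; ring.
rewrite /Rintegral (integral_abel_wave_ge0 e M p q x e0 (lexx _)).
by rewrite (integral_abel_wave_ge0 e M 0 0 x e0 M0)/=; ring.
Qed.

End kernel.

Lemma measurable_wave_comp d (T : measurableType d) (R : realType) D
    (p q x : T -> R) :
  measurable_fun D p -> measurable_fun D q -> measurable_fun D x ->
  measurable_fun D (fun z => wave (p z) (q z) (x z)).
Proof.
move=> mp mq mx; apply: measurable_funB; apply: measurable_funM => //.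
  apply: (measurableT_comp _ mx); apply: continuous_measurable_fun.
  exact: continuous_cos.
apply: (measurableT_comp _ mx); apply: continuous_measurable_fun.
exact: continuous_sin.
Qed.

(** * Integrals of the Poisson kernel over a window *)

Section poisson_window.
Context {R : realType}.
Local Notation mu := (@lebesgue_measure R).
Implicit Types (e x a b s tau : R).

Lemma continuous_poisson_shift e tau : 0 < e ->
  continuous (fun s => poisson e (s - tau)).
Proof.
move=> e0 s; apply: cvgM; first exact: cvg_cst.
apply: cvgV; first by rewrite gt_eqF// sumsq_gt0.
apply: cvgD; first exact: cvg_cst.
by apply: cvgM; apply: cvgB; try exact: cvg_id; exact: cvg_cst.
Qed.

Lemma Rintegral_poisson e a b tau : 0 < e -> a < b ->
  \int[mu]_(s in `[a, b]) poisson e (s - tau) =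
  2 * (atan ((b - tau) / e) - atan ((a - tau) / e)).
Proof.
move=> e0 ab.
pose F s := 2 * atan ((s - tau) / e).
have dF s : is_derive s 1 F (poisson e (s - tau)).
  have dl : is_derive s 1 (fun s => (s - tau) / e) e^-1.
    have -> : (fun s => (s - tau) / e) = e^-1 \*: (id - cst tau).
      by apply/funext => n; rewrite !fctE /= scaleRE mulrC.
    by apply: is_derive_eq; rewrite subr0 scaleRE mulr1.
  have da := @is_derive1_comp R atan _ s _ _ (is_derive1_atan _) dl.
  have -> : F = 2 \*: (atan \o (fun s => (s - tau) / e)).
    by apply/funext => n; rewrite /= scaleRE.
  apply: (is_derive_eq (is_deriveZ _ da)); rewrite scaleRE /poisson.
  have d0 := sumsq_gt0 e (s - tau) e0.
  by field; rewrite !gt_eqF.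
have cF : continuous F.
  by move=> s; apply/differentiable_continuous/derivable1_diffP; case: (dF s).
rewrite /Rintegral (@continuous_FTC2 _ _ F)//.
- by rewrite -EFinB/= /F; ring.
- by apply: continuous_subspaceT => s; exact: (continuous_poisson_shift e tau e0).
- split.
  + by move=> s _; case: (dF s).
  + exact/cvg_at_right_filter/cF.
  + exact/cvg_at_left_filter/cF.
- by move=> s _; rewrite derive1E; case: (dF s).
Qed.

Lemma normr_poisson e x : 0 < e -> `|poisson e x| <= 2 / e.
Proof.
move=> e0; have d0 := sumsq_gt0 e x e0.
rewrite ger0_norm; last by rewrite divr_ge0 ?(ltW d0)// mulr_ge0// ltW.
rewrite /poisson ler_pdivrMr// -subr_ge0 (_ : _ - _ = 2 * x ^+ 2 / e).
  by apply: divr_ge0; [apply: mulr_ge0 => //; exact: sqr_ge0|exact: ltW].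
by field; rewrite gt_eqF.
Qed.

Lemma measurable_poisson e : 0 < e -> measurable_fun setT (poisson e).
Proof.
move=> e0; rewrite (_ : poisson e = fun s => poisson e (s - 0)); last first.
  by apply/funext => s; rewrite subr0.
by apply: continuous_measurable_fun; exact: continuous_poisson_shift.
Qed.

End poisson_window.

(** * Functions with vanishing integrals over intervals *)

Section lebesgue_points.
Context {R : realType}.
Local Notation mu := (@lebesgue_measure R).

(** At a Lebesgue point the value is the limit of the averages over the balls of
radius [1 / (n + 1)], which are all 0. *)
Lemma lebesgue_pt_eq0 (h : R -> R) (t : R) :
  locally_integrable setT h ->
  (forall a b : R, a < b -> \int[mu]_(s in `[a, b]) h s = 0) ->
  lebesgue_pt h t -> h t = 0.
Proof.
move=> lh h0 ht.
pose E (x : R) n := ball x (n.+1%:R^-1 : R).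
have r0 n : (0 < n.+1%:R^-1 :> R) by rewrite invr_gt0.
have shrinkE x : nicely_shrinking x (E x).
  split; first by move=> n; exact: measurable_ball.
  exists (1, fun n => PosNum (r0 n)); split => //=.
  - exact: cvg_harmonic.
  - by move=> n y.
  - by move=> n; rewrite mul1e.
have := nice_lebesgue_differentiation shrinkE lh ht.
have int0 n : (\int[mu]_(y in E t n) (h y)%:E = 0)%E.
  have tn : t - n.+1%:R^-1 < t + n.+1%:R^-1.
    by rewrite ltrBlDr -addrA ltrDl addr_gt0.
  have mh : measurable_fun setT h by case: lh.
  rewrite /E ball_itv -(@integral_itv_bndoo _ _ _ _ true false); last first.
    by apply/measurable_EFinP; exact: measurable_funTS.
  rewrite -[LHS]fineK; first by congr EFin; exact: h0.
  rewrite fin_num_abs.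
  have [_ _ /(_ _ (subsetT _)
    (@segment_compact _ (t - n.+1%:R^-1) (t + n.+1%:R^-1)))] := lh.
  apply: le_lt_trans; apply: le_abse_integral => //.
  by apply/measurable_EFinP; exact: measurable_funTS.
rewrite (_ : (fun n => _) = cst 0%E); last first.
  by apply/funext => n; rewrite int0 mule0.
move=> /(cvg_lim (@ereal_hausdorff R)).
by rewrite lim_cst//; case.
Qed.

Lemma locally_integrable_continuous (h : R -> R) :
  continuous h -> locally_integrable setT h.
Proof.
move=> ch; split; [exact: continuous_measurable_fun|exact: openT|].
move=> K _ cK.
have /integrableP[_] // : mu.-integrable K (EFin \o h).
by apply: continuous_compact_integrable => //; exact: continuous_subspaceT.
Qed.

End lebesgue_points.

(** * Fourier inversion for pairs of real functions *)

Section inversion.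
Context {R : realType}.
Local Notation mu := (@lebesgue_measure R).
Local Notation L1 f := (mu.-integrable setT (EFin \o f)).
Implicit Types (e x a b s t nu tau : R) (p q A B f : R -> R).

Lemma integrable_measurable p : L1 p -> measurable_fun setT p.
Proof. by move=> ip; apply/measurable_EFinP; exact: measurable_int ip. Qed.

Lemma integrable_normD p q : L1 p -> L1 q ->
  L1 (fun x => `|p x| + `|q x|).
Proof.
move=> ip iq.
exact: (integrableD measurableT (integrable_norm ip) (integrable_norm iq)).
Qed.

Lemma integrable_wave p q (x : R -> R) : L1 p -> L1 q ->
  measurable_fun setT x -> L1 (fun z => wave (p z) (q z) (x z)).
Proof.
move=> ip iq mx.
apply: (@le_integrable_EFin _ _ _ mu _ _ (fun x => `|p x| + `|q x|)) => //.
- by apply: measurable_wave_comp => //; exact: integrable_measurable.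
- by move=> z _; exact: normr_wave.
- exact: integrable_normD.
Qed.

(** The real part of [int (A nu + j B nu) exp (j nu s) dnu]. *)
Definition wave_transform A B s := \int[mu]_nu wave (A nu) (B nu) (nu * s).

(** The integrand is continuous in [s] and bounded by [|A| + |B|] uniformly
in [s]. *)
Lemma continuous_wave_transform A B : L1 A -> L1 B ->
  continuous (wave_transform A B).
Proof.
move=> iA iB s.
have sin' : s \in (`]s - 1, s + 1[%classic : set R).
  by rewrite inE/= in_itv/= ltrBlDr ltrDl ltr01.
apply: (@continuity_under_integral _ _ _ mu
  (fun s nu => wave (A nu) (B nu) (nu * s)) setT measurableT (s - 1) (s + 1)
  _ _ _ (integrable_normD A B iA iB) _ s sin').
- by move=> x _; apply: integrable_wave => //; exact: measurable_funM.
- apply: aeW => nu _ x _; rewrite -/(wave (A nu) (B nu) \o (fun x => nu * x)).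
  apply: continuous_comp; last exact: continuous_wave.
  by apply: cvgMl_tmp; exact: cvg_id.
- by move=> x _; apply: aeW => nu _; exact: normr_wave.
Qed.

Lemma normr_wave_transform A B s : L1 A -> L1 B ->
  `|wave_transform A B s| <= \int[mu]_nu (`|A nu| + `|B nu|).
Proof.
move=> iA iB; have iw : L1 (fun nu => wave (A nu) (B nu) (nu * s)).
  by apply: integrable_wave => //; exact: measurable_funM.
rewrite (le_trans (le_normr_Rintegral measurableT iw))//.
apply: le_Rintegral => //.
- exact: integrable_norm.
- exact: integrable_normD.
- by move=> x _; exact: normr_wave.
Qed.

(** The real part of the Fourier transform of [p + j q]; its imaginary part is
[spectrum q (- p)]. *)
Definition spectrum p q nu := \int[mu]_tau wave (p tau) (q tau) (- (nu * tau)).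

(** The addition formulas for sine and cosine, under the integral sign. *)
Lemma wave_spectrum p q nu s : L1 p -> L1 q ->
  wave (spectrum p q nu) (spectrum q (\- p) nu) (nu * s) =
  \int[mu]_tau wave (p tau) (q tau) (nu * (s - tau)).
Proof.
move=> ip iq.
have mx : measurable_fun setT (fun tau => - (nu * tau)).
  by apply: measurableT_comp => //; exact: measurable_funM.
have iNp : L1 (\- p) by exact: (integrableN ip).
have i1 := integrable_wave _ _ _ ip iq mx.
have i2 := integrable_wave _ _ _ iq iNp mx.
rewrite /wave -RintegralZr// -RintegralZr// -RintegralB//; last 2 first.
- by under eq_fun do rewrite mulrC; exact: (integrableZl measurableT _ i1).
- by under eq_fun do rewrite mulrC; exact: (integrableZl measurableT _ i2).
apply: eq_Rintegral => tau _.
rewrite /wave mulrBr cosB sinB cosN sinN /=; ring.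
Qed.

(** The weight makes the double integral in [(nu, tau)] absolutely convergent;
integrating in [nu] first leaves the Poisson kernel. *)
Lemma abel_sum_spectrum e p q s : 0 < e -> L1 p -> L1 q ->
  \int[mu]_nu (abel_weight e nu *
    wave (spectrum p q nu) (spectrum q (\- p) nu) (nu * s)) =
  \int[mu]_tau (p tau * poisson e (s - tau)).
Proof.
move=> e0 ip iq.
pose h (z : R * R) := abel_weight e z.1 * wave (p z.2) (q z.2) (z.1 * (s - z.2)).
transitivity (\int[mu]_nu \int[mu]_tau h (nu, tau)).
  apply: eq_Rintegral => nu _; rewrite wave_spectrum// -RintegralZl//.
  apply: integrable_wave => //; apply: measurable_funM => //.
  exact: measurable_funB.
rewrite (@Rintegral_swap_dominated _ _ _ _ _ mu mu h (abel_weight e)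
  (fun tau => `|p tau| + `|q tau|)).
- by apply: eq_Rintegral => tau _; rewrite /h /= Rintegral_abel_wave.
- apply: measurable_funM.
    by apply: measurableT_comp => //; exact: measurable_abel_weight.
  apply: measurable_wave_comp;
    try by apply: measurableT_comp => //; exact: integrable_measurable.
  apply: measurable_funM => //; exact: measurable_funB.
- move=> z; rewrite normrM ger0_norm ?abel_weight_ge0//.
  by rewrite ler_wpM2l ?abel_weight_ge0// normr_wave.
- exact: integrable_abel_weight.
- exact: integrable_normD.
Qed.

Lemma Rintegral_indic f (D : set R) :
  \int[mu]_(s in D) f s = \int[mu]_s (\1_D s * f s).
Proof.
rewrite Rintegral_mkcond; apply: eq_Rintegral => s _.
by rewrite patchE indicE; case: ifPn; rewrite ?mul1r ?mul0r.
Qed.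

(** The kernel is bounded by [2 / e] and the window has finite length, so the
two integrals may be exchanged; the inner one is then an arctangent. *)
Lemma Rintegral_window_poisson e p a b : 0 < e -> a < b -> L1 p ->
  \int[mu]_(s in `[a, b]) \int[mu]_tau (p tau * poisson e (s - tau)) =
  \int[mu]_tau (p tau * (2 * (atan ((b - tau) / e) - atan ((a - tau) / e)))).
Proof.
move=> e0 ab ip.
have mW : measurable_fun setT (fun z : R * R => poisson e (z.1 - z.2)).
  apply: (measurableT_comp (measurable_poisson e e0)).
  exact: measurable_funB.
have iv : L1 (fun tau => 2 / e * `|p tau|).
  exact: (integrableZl measurableT (2 / e) (integrable_norm ip)).
have mpo (f : R -> R) : measurable_fun setT f ->
    measurable_fun setT (fun tau => poisson e (f tau)).
  by move=> mf; exact: (measurableT_comp (measurable_poisson e e0) mf).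
have iP s : L1 (fun tau => p tau * poisson e (s - tau)).
  apply: (@le_integrable_EFin _ _ _ mu _ _ (fun tau => 2 / e * `|p tau|)) => //.
  - apply: measurable_funM; first exact: integrable_measurable.
    by apply: mpo; exact: measurable_funB.
  - by move=> tau _; rewrite normrM mulrC ler_wpM2r// normr_poisson.
pose h (z : R * R) :=
  \1_(`[a, b]%classic : set R) z.1 * (p z.2 * poisson e (z.1 - z.2)).
transitivity (\int[mu]_s \int[mu]_tau h (s, tau)).
  rewrite Rintegral_indic; apply: eq_Rintegral => s _.
  by rewrite -RintegralZl.
rewrite (@Rintegral_swap_dominated _ _ _ _ _ mu mu h
  (\1_(`[a, b]%classic : set R)) (fun tau => 2 / e * `|p tau|)).
- apply: eq_Rintegral => tau _; rewrite /h /= -Rintegral_indic RintegralZl//.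
    by rewrite Rintegral_poisson.
  apply: continuous_compact_integrable; first exact: segment_compact.
  by apply: continuous_subspaceT => s; exact: (continuous_poisson_shift e tau e0).
- apply: measurable_funM.
    by apply: measurableT_comp => //; exact: measurable_indic.
  apply: measurable_funM => //.
  by apply: measurableT_comp => //; exact: integrable_measurable.
- move=> z; rewrite normrM ger0_norm ?indicE// ler_wpM2l//.
  by rewrite normrM mulrC ler_wpM2r// normr_poisson.
- exact: integrable_indic_itv.
- exact: iv.
Qed.

Lemma cvg_atan_harmonic x : x != 0 ->
  atan (x / n.+1%:R^-1) @[n --> \oo] --> Num.sg x * (pi / 2).
Proof.
wlog x0 : x / 0 < x.
  move=> H xn0; case: (ltrgtP x 0) xn0 => // x0 _; last first.
    by apply: H; rewrite ?gt_eqF.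
  have := H (- x); rewrite oppr_gt0 oppr_eq0 lt_eqF// => /(_ x0 isT).
  move=> /cvgN; rewrite sgrN [in X in _ --> X -> _]mulNr opprK.
  rewrite (_ : - _ = fun n : nat => atan (x / n.+1%:R^-1))//.
  by apply/funext => n; rewrite !fctE mulNr atanN opprK.
move=> _; rewrite gtr0_sg// mul1r.
have xy : x / n.+1%:R^-1 @[n --> \oo] --> +oo.
  have ny : (n.+1%:R : R) @[n --> \oo] --> +oo.
    by rewrite (cvg_shiftS (fun n => n%:R : R)); exact: cvgr_idn.
  under eq_fun do rewrite invrK mulrC.
  exact: (cvg_comp _ _ ny (gt0_cvgMly x0 cvg_id)).
exact: (cvg_comp _ _ xy (@cvgy_atan R)).
Qed.

Lemma normr_atan x : `|atan x| <= pi / 2.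
Proof. by rewrite ler_norml !ltW// ?atan_gtNpi2 ?atan_ltpi2. Qed.

(** The bracket is at most [2 pi] in absolute value, and it converges to [2 pi]
times the indicator of the window except at the two endpoints, a null set. *)
Lemma cvg_Rintegral_window_atan p a b : a < b -> L1 p ->
  \int[mu]_tau (p tau * (2 * (atan ((b - tau) / n.+1%:R^-1) -
                              atan ((a - tau) / n.+1%:R^-1)))) @[n --> \oo] -->
  2 * pi * \int[mu]_(tau in `[a, b]) p tau.
Proof.
move=> ab ip; have mp := integrable_measurable _ ip.
have -> : 2 * pi * \int[mu]_(tau in `[a, b]) p tau =
    \int[mu]_tau (p tau * (2 * pi * \1_(`[a, b]%classic : set R) tau)).
  rewrite Rintegral_indic -RintegralZl//.
    by apply: eq_Rintegral => tau _; ring.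
  apply: (@le_integrable_EFin _ _ _ mu _ _ (fun tau => `|p tau|)) => //.
  - by apply: measurable_funM => //; exact: measurable_indic.
  - move=> tau _; rewrite normrM ler_piMl// indicE.
    by case: (_ \in _); rewrite ?normr1 ?normr0.
  - exact: integrable_norm.
have matan c n :
  measurable_fun setT (fun tau => atan ((c - tau) / n.+1%:R^-1) : R).
  apply: (measurableT_comp (f := atan)).
    by apply: continuous_measurable_fun; exact: continuous_atan.
  by apply: measurable_funM => //; exact: measurable_funB.
apply: (@cvg_Rintegral_dominated _ _ _ mu _ _ _
  (fun tau => 2 * pi * `|p tau|)) => //.
- move=> n; do 2 apply: measurable_funM => //.
  exact: (measurable_funB (matan b n) (matan a n)).
- by do 2 apply: measurable_funM => //; exact: measurable_indic.
- exists [set a; b]; split.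
  + exact: measurableU.
  + by apply/eqP; rewrite measureU0//= ?lebesgue_measure_set1.
  + apply: subsetC2; rewrite setCK => tau /= abt _.
    have [ta tb] : tau != a /\ tau != b.
      by split; apply/eqP => te; apply: abt; [left|right].
    apply: cvgM; first exact: cvg_cst.
    have at_ : a - tau != 0 by rewrite subr_eq0 eq_sym.
    have bt_ : b - tau != 0 by rewrite subr_eq0 eq_sym.
    rewrite (_ : 2 * pi * _ =
      2 * (Num.sg (b - tau) * (pi / 2) - Num.sg (a - tau) * (pi / 2))).
      apply: cvgM; first exact: cvg_cst.
      by apply: cvgB; exact: cvg_atan_harmonic.
    rewrite indicE mem_setE in_itv/=.
    case: (ltrgtP tau a) ta => // ta _.
    + rewrite (gtr0_sg (x := a - tau)) ?subr_gt0//.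
      by rewrite gtr0_sg ?subr_gt0 ?(lt_trans ta)//=; ring.
    + case: (ltrgtP tau b) tb => // tb _.
        by rewrite (ltr0_sg (x := a - tau)) ?subr_lt0// gtr0_sg ?subr_gt0//=; field.
      by rewrite (ltr0_sg (x := a - tau)) ?subr_lt0// ltr0_sg ?subr_lt0//=; ring.
- exact: (integrableZl measurableT (2 * pi) (integrable_norm ip)).
- move=> n tau _; rewrite normrM mulrC ler_wpM2r// normrM ger0_norm//.
  rewrite ler_wpM2l// (le_trans (ler_normB _ _))//.
  have -> : pi = pi / 2 + pi / 2 :> R by field.
  by rewrite lerD// normr_atan.
Qed.

Lemma cvg_abel_weight nu :
  abel_weight (n.+1%:R^-1) nu @[n --> \oo] --> (1 : R).
Proof.
have e0 : - n.+1%:R^-1 * `|nu| @[n --> \oo] --> (0 : R).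
  rewrite -[X in _ --> X](mul0r `|nu|); apply: cvgMr_tmp.
  by rewrite -oppr0; apply: cvgN; exact: cvg_harmonic.
by rewrite -[X in _ --> X]expR0; exact: (cvg_comp _ _ e0 (@continuous_expR R 0)).
Qed.

Lemma wave_scale (k u v : R) x : k * wave u v x = wave (k * u) (k * v) x.
Proof. by rewrite /wave; ring. Qed.

(** Dominated convergence twice: in [nu] for each [s], with bound [|A| + |B|],
then in [s], with the constant bound [int (|A| + |B|)]. *)
Lemma cvg_Rintegral_window_abel A B a b : a < b -> L1 A -> L1 B ->
  \int[mu]_(s in `[a, b]) \int[mu]_nu
     (abel_weight (n.+1%:R^-1) nu * wave (A nu) (B nu) (nu * s)) @[n --> \oo] -->
  \int[mu]_(s in `[a, b]) wave_transform A B s.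
Proof.
move=> ab iA iB.
pose C := \int[mu]_nu (`|A nu| + `|B nu|).
have iw (e : R) f : 0 < e -> L1 f -> L1 (fun nu => abel_weight e nu * f nu).
  move=> e0 if_.
  apply: (@le_integrable_EFin _ _ _ mu _ _ (fun tau => `|f tau|)) => //.
  - apply: measurable_funM; last exact: integrable_measurable.
    exact: measurable_abel_weight.
  - move=> nu _; rewrite normrM ler_piMl// ger0_norm ?abel_weight_ge0//.
    exact: abel_weight_le1.
  - exact: integrable_norm.
(* The damped integrals are again wave transforms, hence continuous in s. *)
have wE n s : \int[mu]_nu
     (abel_weight (n.+1%:R^-1) nu * wave (A nu) (B nu) (nu * s)) = wave_transform (fun nu => abel_weight (n.+1%:R^-1) nu * A nu)
                    (fun nu => abel_weight (n.+1%:R^-1) nu * B nu) s.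
  by apply: eq_Rintegral => nu _; rewrite wave_scale.
have e0 n : (0 : R) < n.+1%:R^-1 by rewrite invr_gt0.
apply: (@cvg_Rintegral_dominated _ _ _ mu _ _ _ (cst C)) => //.
- move=> n; rewrite (funext (wE n)).
  apply: measurable_funTS; apply: continuous_measurable_fun.
  by apply: continuous_wave_transform; exact: iw.
- apply: measurable_funTS; apply: continuous_measurable_fun.
  exact: continuous_wave_transform.
- apply: aeW => s _.
  apply: (@cvg_Rintegral_dominated _ _ _ mu _ _ _
    (fun nu => `|A nu| + `|B nu|)) => //.
  + move=> n; apply: measurable_funM; first exact: measurable_abel_weight.
    by apply: measurable_wave_comp;
      [exact: integrable_measurable..|exact: measurable_funM].
  + by apply: measurable_wave_comp;
      [exact: integrable_measurable..|exact: measurable_funM].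
  + apply: aeW => nu _; rewrite -[X in _ --> X]mul1r.
    by apply: cvgMr_tmp; exact: cvg_abel_weight.
  + exact: integrable_normD.
  + move=> n nu _; rewrite normrM ger0_norm ?abel_weight_ge0//.
    rewrite (le_trans _ (normr_wave _ _ (nu * s)))//.
    by rewrite ler_piMl// abel_weight_le1.
- apply: continuous_compact_integrable; first exact: segment_compact.
  by apply: continuous_subspaceT => s; exact: cvg_cst.
- move=> n s _; rewrite wE (le_trans (normr_wave_transform _ _ _
    (iw _ _ (e0 n) iA) (iw _ _ (e0 n) iB)))//.
  apply: le_Rintegral => //.
  + by apply: integrable_normD; exact: iw.
  + exact: integrable_normD.
  + move=> nu _; rewrite !normrM ger0_norm ?abel_weight_ge0//.
    by rewrite lerD// ler_piMl// abel_weight_le1.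
Qed.

(** Both sides are limits, as [n] grows, of the same Abel means with
[e = 1 / (n + 1)]. *)
Lemma Rintegral_window_inversion p q a b : a < b -> L1 p -> L1 q ->
  L1 (spectrum p q) -> L1 (spectrum q (\- p)) ->
  \int[mu]_(s in `[a, b]) wave_transform (spectrum p q) (spectrum q (\- p)) s =
  2 * pi * \int[mu]_(s in `[a, b]) p s.
Proof.
move=> ab ip iq iA iB.
have e0 n : (0 : R) < n.+1%:R^-1 by rewrite invr_gt0.
have lhs := cvg_Rintegral_window_abel _ _ _ _ ab iA iB.
have := cvg_Rintegral_window_atan p a b ab ip.
rewrite (_ : (fun n : nat => _) = (fun n : nat =>
   \int[mu]_(s in `[a, b]) \int[mu]_nu
     (abel_weight (n.+1%:R^-1) nu *
      wave (spectrum p q nu) (spectrum q (\- p) nu) (nu * s)))); last first.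
  apply/funext => n; rewrite -Rintegral_window_poisson//.
  by apply: eq_Rintegral => s _; rewrite abel_sum_spectrum.
move=> /cvg_lim <-//.
by apply/esym/cvg_lim.
Qed.

Definition inversion_defect p q s : R :=
  2 * pi * p s - wave_transform (spectrum p q) (spectrum q (\- p)) s.

Section defect.
Variables p q : R -> R.
Hypotheses (ip : L1 p) (iq : L1 q).
Hypotheses (iA : L1 (spectrum p q)) (iB : L1 (spectrum q (\- p))).

Lemma locally_integrable_inversion_defect :
  locally_integrable setT (inversion_defect p q).
Proof.
apply: locally_integrableB.
  apply: open_integrable_locally; first exact: openT.
  exact: (integrableZl measurableT (2 * pi) ip).
by apply: locally_integrable_continuous; exact: continuous_wave_transform.
Qed.

Lemma lebesgue_pt_inversion_defect t : lebesgue_pt (inversion_defect p q) t ->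
  wave_transform (spectrum p q) (spectrum q (\- p)) t = 2 * pi * p t.
Proof.
move=> ht; apply/esym/eqP; rewrite -subr_eq0; apply/eqP.
apply: (lebesgue_pt_eq0 (inversion_defect p q)) => //.
  exact: locally_integrable_inversion_defect.
move=> a b ab; rewrite RintegralB//.
- rewrite RintegralZl// ?Rintegral_window_inversion ?subrr//.
  exact: (integrableS measurableT _ _ ip).
- exact: (integrableS measurableT _ _ (integrableZl measurableT (2 * pi) ip)).
- apply: continuous_compact_integrable; first exact: segment_compact.
  by apply: continuous_subspaceT; exact: continuous_wave_transform.
Qed.

Lemma ae_inversion : {ae mu, forall t,
  wave_transform (spectrum p q) (spectrum q (\- p)) t = 2 * pi * p t}.
Proof.
have [N [mN N0 subN]] :=
  lebesgue_differentiation locally_integrable_inversion_defect.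
exists N; split=> //; apply: subset_trans subN => t; apply: contra_not.
exact: lebesgue_pt_inversion_defect.
Qed.

Lemma continuous_inversion t : {for t, continuous p} ->
  wave_transform (spectrum p q) (spectrum q (\- p)) t = 2 * pi * p t.
Proof.
move=> ct; apply: lebesgue_pt_inversion_defect.
have [mh _ _] := locally_integrable_inversion_defect.
apply: (@continuous_lebesgue_pt _ _ _ setT) => //.
  by split => //; exact: openT.
apply: cvgB; last exact: continuous_wave_transform.
by apply: cvgMl_tmp; exact: ct.
Qed.

End defect.

End inversion.

Local Open Scope complex_scope.

(** * Complex signals *)

Section complex_signals.
Context {R : realType}.
Local Notation mu := (@lebesgue_measure R).
Local Notation L1 f := (mu.-integrable setT (EFin \o f)).
Local Notation Re := complex.Re.
Local Notation Im := complex.Im.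
Implicit Types (x y t nu omega : R) (f g : signal R) (z c : R[i]).

Definition cis x : R[i] := cos x +i* sin x.

Lemma cisD x y : cis (x + y) = cis x * cis y.
Proof. by rewrite /cis cosD sinD; simpc; congr (_ +i* _); ring. Qed.

Lemma mulr_cisN z x : z * cis x * cis (- x) = z.
Proof.
rewrite -mulrA -cisD subrr /cis cos0 sin0.
by case: z => a b; simpc.
Qed.

Lemma Re_mul_cis z x : Re (z * cis x) = wave (Re z) (Im z) x.
Proof. by case: z. Qed.

Lemma Im_mul_cis z x : Im (z * cis x) = wave (Im z) (- Re z) x.
Proof. by case: z => a b; rewrite /wave /=; ring. Qed.

Lemma cexp_jC x : cexp (jC * x%:C) = cis x.
Proof. by rewrite /cexp /jC /cis; simpc => /=; rewrite expR0; simpc. Qed.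

Lemma cexp_NjC x : cexp (- jC * x%:C) = cis (- x).
Proof. by rewrite /cexp /jC /cis; simpc => /=; rewrite expR0; simpc. Qed.

Lemma ler_normr_Re z : `|Re z| <= Normc.normc z.
Proof.
case: z => a b /=; rewrite -sqrtr_sqr ler_sqrt ?addr_ge0 ?sqr_ge0//.
by rewrite lerDl sqr_ge0.
Qed.

Lemma ler_normr_Im z : `|Im z| <= Normc.normc z.
Proof.
case: z => a b /=; rewrite -sqrtr_sqr ler_sqrt ?addr_ge0 ?sqr_ge0//.
by rewrite lerDr sqr_ge0.
Qed.

Lemma normc_ge0 z : 0 <= Normc.normc z.
Proof. exact: le_trans (normr_ge0 _) (ler_normr_Re z). Qed.

Lemma normc_le_ReIm z : Normc.normc z <= `|Re z| + `|Im z|.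
Proof.
case: z => a b /=.
rewrite -(@ger0_norm _ (`|a| + `|b|)) ?addr_ge0// -sqrtr_sqr.
rewrite ler_sqrt ?sqr_ge0// sqrrD !real_normK ?num_real//.
by rewrite -addrA lerD2l lerDr mulrn_wge0// mulr_ge0.
Qed.

Lemma measurable_normc f : measurable_fun setT (fun x => Re (f x)) ->
  measurable_fun setT (fun x => Im (f x)) ->
  measurable_fun setT (fun x => Normc.normc (f x)).
Proof.
move=> mR mI.
rewrite (_ : (fun x => _) =
  fun x => Num.sqrt (Re (f x) ^+ 2 + Im (f x) ^+ 2)); last first.
  by apply/funext => x; case: (f x).
apply: measurableT_comp.
  by apply: continuous_measurable_fun; exact: sqrt_continuous.
by apply: measurable_funD; exact: measurable_funX.
Qed.

(** The modulus and the pair of absolute components dominate each other. *)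
Lemma abs_integrableP f : abs_integrable f <->
  L1 (fun x => Re (f x)) /\ L1 (fun x => Im (f x)).
Proof.
split=> [[mR mI fy]|[iR iI]].
  have iN : L1 (fun x => Normc.normc (f x)).
    apply/integrableP; split.
      by apply/measurable_EFinP; exact: measurable_normc.
    apply: le_lt_trans fy; rewrite le_eqVlt; apply/orP; left; apply/eqP.
    by apply: eq_integral => x _; rewrite /= ger0_norm ?normc_ge0.
  split; apply: (@le_integrable_EFin _ _ _ mu _ _
    (fun x => Normc.normc (f x))) => //.
    by move=> x _; exact: ler_normr_Re.
  by move=> x _; exact: ler_normr_Im.
have mR := integrable_measurable _ iR; have mI := integrable_measurable _ iI.
split=> //.
have /integrableP[_] : L1 (fun x => Normc.normc (f x)).
  apply: (@le_integrable_EFin _ _ _ mu _ _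
    (fun x => `|Re (f x)| + `|Im (f x)|)) => //.
  - exact: measurable_normc.
  - move=> x _; rewrite ger0_norm ?normc_le_ReIm//.
    exact: normc_ge0.
  - exact: integrable_normD.
apply: le_lt_trans; apply: ge0_le_integral => //=.
- by move=> x _; rewrite lee_fin normc_ge0.
- by apply/measurable_EFinP; exact: measurable_normc.
- apply/measurable_EFinP; apply: measurableT_comp => //.
  exact: measurable_normc.
- by move=> x _; rewrite lee_fin ler_norm.
Qed.

Lemma abs_integrable_mul_cis f (x : R -> R) : abs_integrable f ->
  measurable_fun setT x -> abs_integrable (fun s => f s * cis (x s)).
Proof.
move=> /abs_integrableP[iR iI] mx; apply/abs_integrableP; split.
  under eq_fun do rewrite Re_mul_cis.
  exact: integrable_wave.
under eq_fun do rewrite Im_mul_cis.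
apply: integrable_wave => //; exact: (integrableN iR).
Qed.

Lemma cintegral_mulr f c : abs_integrable f ->
  cintegral (fun s => f s * c) = cintegral f * c.
Proof.
move=> /abs_integrableP[iR iI]; case: c => a b; rewrite /cintegral; simpc.
have iZ (k : R) (g : R -> R) : L1 g -> L1 (fun x => g x * k).
  move=> ig; under eq_fun do rewrite mulrC.
  exact: (integrableZl measurableT k ig).
congr (_ +i* _).
  rewrite -!RintegralZr// -RintegralB//; [|exact: iZ..].
  by apply: eq_Rintegral => x _; case: (f x).
rewrite -!RintegralZr// -RintegralD//; [|exact: iZ..].
by apply: eq_Rintegral => x _; case: (f x) => u v /=.
Qed.

Lemma fourierE f nu :
  fourier f nu = cintegral (fun tau => f tau * cis (- (nu * tau))).
Proof. by rewrite /fourier; under eq_fun do rewrite cexp_NjC. Qed.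

Lemma conv_xsigE f omega t :
  (fun tau => f tau * xsig omega (t - tau)) =
  (fun tau => f tau * cis (- (omega * tau)) * cis (omega * t)).
Proof.
apply/funext => tau; rewrite /xsig cexp_jC -mulrA -cisD.
by congr (_ * cis _); ring.
Qed.

Lemma conv_xbarE g omega t :
  (fun nu => g nu * xbar t (omega - nu)) =
  (fun nu => g nu * cis (nu * t) * cis (- (omega * t))).
Proof.
apply/funext => nu; rewrite /xbar cexp_NjC -mulrA -cisD.
by congr (_ * cis _); ring.
Qed.

Lemma conv_xsig f omega t : abs_integrable f ->
  conv_defined f (xsig omega) t /\
  conv f (xsig omega) t = fourier f omega * xsig omega t.
Proof.
move=> fi; have ci : abs_integrable (fun tau => f tau * cis (- (omega * tau))).
  apply: abs_integrable_mul_cis => //.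
  by apply: measurableT_comp => //; exact: measurable_funM.
rewrite /conv_defined /conv conv_xsigE; split.
  by apply: abs_integrable_mul_cis => //; exact: measurable_cst.
by rewrite cintegral_mulr// fourierE /xsig cexp_jC.
Qed.

(** Multiplication by the inverse exponentials recovers [g] from the integrand of
the convolution. *)
Lemma conv_xbar_defined g omega t :
  conv_defined g (xbar t) omega -> abs_integrable g.
Proof.
rewrite /conv_defined conv_xbarE => gi.
have mt : measurable_fun setT (fun nu => - (nu * t)).
  by apply: measurableT_comp => //; exact: measurable_funM.
have := abs_integrable_mul_cis _ _ gi (measurable_cst (omega * t)).
move=> /abs_integrable_mul_cis/(_ mt); congr abs_integrable.
apply/funext => nu.
by rewrite -{2}[omega * t]opprK !mulr_cisN.
Qed.

Lemma conv_xbar g omega t : abs_integrable g ->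
  conv g (xbar t) omega =
  cintegral (fun nu => g nu * cis (nu * t)) * xbar t omega.
Proof.
move=> gi; rewrite /conv conv_xbarE cintegral_mulr ?/xbar ?cexp_NjC//.
by apply: abs_integrable_mul_cis => //; exact: measurable_funM.
Qed.

Lemma Re_fourier f :
  (fun nu => Re (fourier f nu)) =
  spectrum (fun x => Re (f x)) (fun x => Im (f x)).
Proof.
apply/funext => nu; rewrite fourierE /=.
by apply: eq_Rintegral => tau _; rewrite Re_mul_cis.
Qed.

Lemma Im_fourier f :
  (fun nu => Im (fourier f nu)) =
  spectrum (fun x => Im (f x)) (\- (fun x => Re (f x))).
Proof.
apply/funext => nu; rewrite fourierE /=.
by apply: eq_Rintegral => tau _; rewrite Im_mul_cis.
Qed.

Lemma cintegral_mul_cis g t : cintegral (fun nu => g nu * cis (nu * t)) =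
  wave_transform (fun nu => Re (g nu)) (fun nu => Im (g nu)) t +i*
  wave_transform (fun nu => Im (g nu)) (\- (fun nu => Re (g nu))) t.
Proof.
congr (_ +i* _); apply: eq_Rintegral => nu _.
  by rewrite Re_mul_cis.
by rewrite Im_mul_cis.
Qed.

Lemma spectrumN (p q : R -> R) : L1 p -> L1 q ->
  spectrum (\- p) (\- q) = \- spectrum p q.
Proof.
move=> ip iq; apply/funext => nu; rewrite /spectrum /= -mulN1r -RintegralZl//.
  by apply: eq_Rintegral => tau _; rewrite /wave /=; ring.
apply: integrable_wave => //.
by apply: measurableT_comp => //; exact: measurable_funM.
Qed.

Section inversion.
Variable f : signal R.
Hypotheses (fi : abs_integrable f) (Fi : abs_integrable (fourier f)).
Let p x := Re (f x).
Let q x := Im (f x).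

Let ip : L1 p. Proof. by case/abs_integrableP: fi. Qed.
Let iq : L1 q. Proof. by case/abs_integrableP: fi. Qed.
Let iNp : L1 (\- p). Proof. exact: (integrableN ip). Qed.

Let iA : L1 (spectrum p q).
Proof. by case/abs_integrableP: Fi; rewrite Re_fourier. Qed.

Let iB : L1 (spectrum q (\- p)).
Proof. by case/abs_integrableP: Fi; rewrite Im_fourier. Qed.

Let iNA : L1 (spectrum (\- p) (\- q)).
Proof. by rewrite spectrumN//; exact: (integrableN iA). Qed.

(** The second hypothesis is the first one for [- j f], whose real part is the
imaginary part [q] of [f] and whose transform is [- j F]. *)
Lemma fourier_inversion t :
  wave_transform (spectrum p q) (spectrum q (\- p)) t = 2 * pi * p t ->
  wave_transform (spectrum q (\- p)) (spectrum (\- p) (\- q)) t = 2 * pi * q t ->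
  cintegral (fun nu => fourier f nu * cis (nu * t)) = (2 * pi)%:C * f t.
Proof.
rewrite cintegral_mul_cis Re_fourier Im_fourier spectrumN// => -> ->.
by rewrite /p /q; case: (f t) => u v; simpc.
Qed.

Lemma ae_fourier_inversion : {ae mu, forall t,
  cintegral (fun nu => fourier f nu * cis (nu * t)) = (2 * pi)%:C * f t}.
Proof.
have [N [mN N0 subN]] := ae_inversion p q ip iq iA iB.
have [M [mM M0 subM]] := ae_inversion q (\- p) iq iNp iB iNA.
exists (N `|` M); split; [exact: measurableU|by rewrite measureU0|].
move=> t /= nt; apply: contrapT => /not_orP[Nt Mt]; apply: nt.
apply: fourier_inversion.
  by apply: contrapT => h; apply: Nt; exact: subN.
by apply: contrapT => h; apply: Mt; exact: subM.
Qed.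

Lemma continuous_fourier_inversion t : csignal_continuous_at f t ->
  cintegral (fun nu => fourier f nu * cis (nu * t)) = (2 * pi)%:C * f t.
Proof.
move=> [cp cq]; apply: fourier_inversion.
  exact: (continuous_inversion p q ip iq iA iB t cp).
exact: (continuous_inversion q (\- p) iq iNp iB iNA t cq).
Qed.

End inversion.
End complex_signals.

Theorem proposition3p4 (R : realType) (f : signal R) (hf : abs_integrable f) :
  let F := fourier f in
  (forall omega t : R,
      conv_defined f (xsig omega) t /\
      conv f (xsig omega) t = F omega * xsig omega t) /\
  {ae lebesgue_measure, forall t : R, forall omega : R,
      conv_defined F (xbar t) omega ->
      conv F (xbar t) omega = (2 * pi)%:C * f t * xbar t omega} /\
  (forall t : R, csignal_continuous_at f t -> forall omega : R,
      conv_defined F (xbar t) omega ->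
      conv F (xbar t) omega = (2 * pi)%:C * f t * xbar t omega).
Proof.
move=> F; split; [|split].
- by move=> omega t; exact: conv_xsig.
(* When F is not absolutely integrable, no convolution with it is defined. *)
- have [Fi|nFi] := pselect (abs_integrable F); last first.
    by apply: aeW => t omega /conv_xbar_defined.
  have [N [mN N0 subN]] := ae_fourier_inversion f hf Fi.
  exists N; split=> //; apply: subset_trans subN => t.
  apply: contra_not => Et omega _.
  by rewrite conv_xbar// Et.
- move=> t ct omega /conv_xbar_defined Fi.
  by rewrite conv_xbar// continuous_fourier_inversion.
Qed.
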